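(* Let $T$ be a tree with $n$ vertices. Then $\gamma_{B_2}(T)\le \lceil 4n/9\rceil$. Moreover, $\gamma_{B_2}(T)=\lceil 4n/9\rceil$ if and only if $T\in\mathcal{F}\cup\{P_1,P_2,P_4\}$.
   Context: Graphs are finite, undirected, simple and connected; $d(u,v)$ denotes the graph distance. A dominating $2$-broadcast on a graph $G$ is a function $f\colon V(G)\to\{0,1,2\}$ such that for every $u\in V(G)$ there is a vertex $v\in V(G)$ with $f(v)\ge 1$ and $d(u,v)\le f(v)$. Its cost is $\omega(f)=\sum_{v\in V(G)} f(v)$, and $\gamma_{B_2}(G)$ is the minimum cost of a dominating $2$-broadcast on $G$. $P_k$ denotes the path with $k$ vertices. $T_9$ denotes the tree with $9$ vertices obtained from two disjoint copies of $P_4$ and one additional vertex $x$ (the central vertex of $T_9$) by joining $x$ by an edge to one internal (non-leaf) vertex of each copy of $P_4$. $\mathcal{F}$ is the family of all trees consisting of $m$ disjoint copies of $T_9$, for some $m\ge 1$, together with $m-1$ edges, each of them joining the central vertices of two copies (so such a tree has $9m$ vertices). Membership in $\mathcal{F}\cup\{P_1,P_2,P_4\}$ is understood up to isomorphism. *)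

(* Defs.v *)
(* MathComp world *)
From mathcomp Require Import all_boot all_order all_algebra.

Set Implicit Arguments.
Unset Strict Implicit.
Unset Printing Implicit Defensive.

Record sgraph := SGraph {
  svertex :> finType;
  adj : rel svertex;
  adj_sym : symmetric adj;
  adj_irrefl : irreflexive adj }.

Definition edges (G : sgraph) : {set {set G}} :=
  [set [set p.1; p.2] | p : G * G & adj p.1 p.2].

Definition isomorphic (G H : sgraph) : Prop :=
  exists2 f : G -> H, bijective f & forall x y, adj (f x) (f y) = adj x y.

(* [ucycle adj c] alone also holds for the empty sequence and for the
   two-vertex sequence of a single edge, whence the bound on the size. *)
Definition acyclic (G : sgraph) : Prop :=
  forall c : seq G, 2 < size c -> ~ ucycle (@adj G) c.

Definition is_tree (G : sgraph) : Prop :=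
  [/\ 0 < #|G|, forall u v : G, connect (@adj G) u v & acyclic G].

Definition walk_of_length (G : sgraph) (k : nat) (u v : G) : bool :=
  [exists p : k.-tuple G, path (@adj G) u p && (last u p == v)].

(* Least length of a walk from u to v; a shortest walk has fewer than #|G|
   edges. Meant for connected graphs: the value is the junk value #|G| when v
   is not reachable from u. *)
Definition gdist (G : sgraph) (u v : G) : nat :=
  find (fun k => walk_of_length k u v) (iota 0 #|G|).

Definition dominating (G : sgraph) (f : {ffun G -> 'I_3}) : bool :=
  [forall u, exists v, (1 <= f v) && (gdist u v <= f v)].

Definition cost (G : sgraph) (f : {ffun G -> 'I_3}) : nat := \sum_v f v.

Lemma gdistxx (G : sgraph) (u : G) : gdist u u = 0.
Proof.
rewrite /gdist; have : 0 < #|G| by apply/card_gt0P; exists u.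
case: #|G| => [//|n] _ /=.
suff -> : walk_of_length 0 u u by [].
by apply/existsP; exists [tuple]; rewrite /= eqxx.
Qed.

Lemma dominating_cost_ex (G : sgraph) :
  exists k, [exists f : {ffun G -> 'I_3}, dominating f && (cost f == k)].
Proof.
exists (cost [ffun _ : G => inord 1 : 'I_3]); apply/existsP.
exists [ffun _ : G => inord 1 : 'I_3]; rewrite eqxx andbT.
apply/forallP => u; apply/existsP; exists u.
by rewrite gdistxx ffunE inordK.
Qed.

Definition gamma_B2 (G : sgraph) : nat := ex_minn (dominating_cost_ex G).

Section Path.
Variable k : nat.

Definition path_adj : rel 'I_k := fun i j =>
  (i.+1 == j :> nat) || (j.+1 == i :> nat).

Lemma path_adj_sym : symmetric path_adj.
Proof. by move=> i j; rewrite /path_adj orbC. Qed.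

Lemma path_adj_irrefl : irreflexive path_adj.
Proof. by move=> i; rewrite /path_adj orbb eqn_leq ltnn. Qed.

Definition path_graph : sgraph := SGraph path_adj_sym path_adj_irrefl.
End Path.

(* [None] is the central vertex and [Some (b, i)] the i-th vertex of the copy b
   of P_4; of the two internal vertices 1 and 2 of P_4, which an automorphism
   exchanges, 1 is the one joined to the centre. *)
Definition T9_adj : rel (option (bool * 'I_4)) := fun s t =>
  match s, t with
  | None, None => false
  | None, Some (_, i) | Some (_, i), None => i == 1 :> nat
  | Some (b, i), Some (c, j) => (b == c) && @adj (path_graph 4) i j
  end.

Lemma T9_adj_sym : symmetric T9_adj.
Proof.
by case=> [[b i]|] [[c j]|] //=; rewrite eq_sym; congr andb; apply: orbC.
Qed.

Lemma T9_adj_irrefl : irreflexive T9_adj.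
Proof. by case=> [[b i]|] //=; rewrite eqxx; apply: path_adj_irrefl. Qed.

Definition T9 : sgraph := SGraph T9_adj_sym T9_adj_irrefl.

Definition T9_center : T9 := None.

(* One copy of T_9 for each vertex of Q, and one edge between the central
   vertices of two copies for each edge of Q. *)
Section JoinT9.
Variable Q : sgraph.

Definition joinT9_adj : rel (Q * T9) := fun s t =>
  ((s.1 == t.1) && adj s.2 t.2) ||
  [&& s.2 == T9_center, t.2 == T9_center & adj s.1 t.1].

Lemma joinT9_adj_sym : symmetric joinT9_adj.
Proof.
by move=> s t; rewrite /joinT9_adj eq_sym adj_sym [adj s.1 _]adj_sym andbCA.
Qed.

Lemma joinT9_adj_irrefl : irreflexive joinT9_adj.
Proof. by move=> s; rewrite /joinT9_adj !adj_irrefl !andbF. Qed.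

Definition joinT9 : sgraph := SGraph joinT9_adj_sym joinT9_adj_irrefl.
End JoinT9.

Definition in_family_F (G : sgraph) : Prop :=
  is_tree G /\
  exists m : nat, exists Q : sgraph,
    [/\ 1 <= m, #|Q| = m, #|edges Q| = m - 1 & isomorphic G (joinT9 Q)].

(* Main.v *)
Require Import Defs.
From mathcomp Require Import all_boot all_order all_algebra.
From mathcomp Require Import zify.

Set Implicit Arguments.
Unset Strict Implicit.
Unset Printing Implicit Defensive.

Import GRing.Theory Num.Theory.

(** Write n for the number of vertices and call a tree tight when
    4n <= 9 gamma.  Since gamma <= ceil(4n/9) means 9 gamma < 4n + 9, and
    ceil(4n/9) <= gamma means 4n <= 9 gamma, it has to be shown that
    9 gamma < 4n + 9 for every tree, and that the tight trees are P_1, P_2, P_4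
    and the members of the family.

    Every finite tree is built from single vertices by grafting: [Graft a b]
    makes the root of [b] a new child of the root of [a]
    ([tree_decomposes]).  For an unfinished rooted tree, all that the rest of
    the tree can observe of a broadcast is the signal at the root: how far the
    broadcasts heard there still reach, and whether the root hears one from
    inside the tree or relies on a vertex outside.  There are five
    signals, and a rooted tree with n vertices has a profile: for each signal an
    upper bound on 9 w - 4 n, where w is the least cost of a broadcast
    realizing it.  Grafting acts on profiles by a min-plus product
    ([covers], [admits_Graft]).

    A profile is worth knowing only up to larger profiles, and since the
    family attains 4n/9 the bounds stay in a bounded window, so finitely
    many profiles are enough. Twenty suffice: seven slack profiles, whose
    bound for gamma is negative and which absorb each of the twenty when
    grafted with it ([slack_absorbs]), and thirteen extremal ones, each of
    which comes with a description of the rooted trees that need it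
    ([extremal]). These trees are the pieces met when P_1, P_2, P_4 or a
    member of the family is put together by grafting, and only twenty-five
    pairs of such shapes have a graft that escapes the slack profiles
    ([extremal_Graft]). The resulting [classification] gives both the bound
    ([gamma_B2_lt]) and the shape of the tight trees ([gamma_B2_extremal]).

    Conversely, the two leaves of a copy of P_4 force cost 4 onto each copy
    of T_9, wherever the other broadcasts are ([gamma_B2_joinT9]). *)

(** * Walks, distances and isomorphisms *)

Lemma walkP (G : sgraph) k (u v : G) :
  reflect (exists p, [/\ path (@adj G) u p, last u p = v & size p = k])
          (walk_of_length k u v).
Proof.
apply: (iffP existsP) => [[p /andP[pth /eqP lst]]|[p [pth lst sz]]].
  by exists p; rewrite size_tuple.
have sz' : size p == k by apply/eqP.
by exists (Tuple sz') => /=; rewrite pth lst eqxx.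
Qed.

(** When [k] is at least the order of the graph, it also bounds the junk value
    of [gdist]. *)
Lemma gdist_le_walk (G : sgraph) k (u v : G) :
  walk_of_length k u v -> gdist u v <= k.
Proof.
move=> w; rewrite /gdist; have [ltkG|leGk] := ltnP k #|G|; last first.
  by apply: leq_trans leGk; rewrite -[leqRHS](size_iota 0) find_size.
rewrite leqNgt; apply/negP => /(before_find 0).
by rewrite nth_iota // add0n w.
Qed.

(** The bound on [k] excludes the junk value of [gdist]. *)
Lemma walk_le_gdist (G : sgraph) k (u v : G) :
  gdist u v <= k -> k < #|G| -> exists2 j, j <= k & walk_of_length j u v.
Proof.
move=> le_k ltk; exists (gdist u v) => //.
have lt_size : gdist u v < #|G| by apply: leq_ltn_trans ltk.
have := @nth_find _ 0 (fun k => walk_of_length k u v) (iota 0 #|G|).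
rewrite has_find size_iota -/(gdist u v) => /(_ lt_size).
by rewrite nth_iota.
Qed.

Lemma isomorphic_sym G H : isomorphic G H -> isomorphic H G.
Proof.
case=> f [g fK gK] fadj; exists g; first by exists f.
by move=> x y; rewrite -fadj !gK.
Qed.

Lemma walk_morph (G H : sgraph) (f : G -> H) k u v :
  (forall x y, adj x y -> adj (f x) (f y)) ->
  walk_of_length k u v -> walk_of_length k (f u) (f v).
Proof.
move=> fadj /walkP[p [pth <- <-]]; apply/walkP; exists (map f p).
rewrite last_map size_map; split=> //.
by rewrite path_map; apply: sub_path pth.
Qed.

Lemma gamma_B2_ge (G : sgraph) c :
  (forall f : {ffun G -> 'I_3}, dominating f -> c <= cost f) -> c <= gamma_B2 G.
Proof.
move=> le_c; rewrite /gamma_B2; case: ex_minnP => k /existsP[f /andP[df /eqP <-]] _.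
exact: le_c.
Qed.

Lemma gamma_B2_le (G : sgraph) (f : {ffun G -> 'I_3}) :
  dominating f -> gamma_B2 G <= cost f.
Proof.
move=> df; rewrite /gamma_B2; case: ex_minnP => k _; apply.
by apply/existsP; exists f; rewrite df eqxx.
Qed.

Lemma gamma_B2_iso_le (G H : sgraph) :
  isomorphic G H -> gamma_B2 G <= gamma_B2 H.
Proof.
move=> isoGH; have [f [g fK gK] fadj] := isoGH.
apply: gamma_B2_ge => b db.
have gd u v : gdist (g u) (g v) = gdist u v.
  rewrite /gdist (bij_eq_card (Bijective fK gK)).
  apply: eq_find => k; apply/idP/idP => w.
    by rewrite -(gK u) -(gK v); apply: walk_morph w => x y; rewrite fadj.
  by apply: walk_morph w => x y; rewrite -fadj !gK.
suff dG : dominating [ffun x => b (f x)].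
  apply: leq_trans (gamma_B2_le dG) _.
  rewrite /cost [leqRHS](reindex f) /=; last by apply: onW_bij; exists g.
  by apply: eq_leq; apply: eq_bigr => x _; rewrite ffunE.
apply/forallP => u; have /forallP/(_ (f u))/existsP[v] := db.
move=> dv; apply/existsP; exists (g v); rewrite ffunE gK.
by rewrite -{1}(fK u) gd.
Qed.

Lemma gamma_B2_iso (G H : sgraph) :
  isomorphic G H -> gamma_B2 G = gamma_B2 H.
Proof.
move=> iso; apply/eqP; rewrite eqn_leq gamma_B2_iso_le //=.
exact/gamma_B2_iso_le/isomorphic_sym.
Qed.

Lemma card_iso (G H : sgraph) : isomorphic G H -> #|G| = #|H|.
Proof. by case=> f fbij _; apply: bij_eq_card fbij. Qed.

(** * Rooted trees built by grafting *)

(** The binary shape (a root subtree and one more child) makes grafting the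
    only operation, so that an invariant of rooted trees is checked on pairs.
    The labels are vertices of an ambient graph. *)
Inductive rtree (V : Type) := Vertex of V | Graft of rtree V & rtree V.

Section RTree.
Variable V : eqType.
Implicit Types (a b t : rtree V) (u v w x y : V).

Fixpoint apex t := match t with Vertex x => x | Graft a _ => apex a end.

Fixpoint verts t :=
  match t with Vertex x => [:: x] | Graft a b => verts a ++ verts b end.

Definition link u v x y := (x == u) && (y == v) || (x == v) && (y == u).

Fixpoint ladj t x y :=
  if t is Graft a b then [|| link (apex a) (apex b) x y, ladj a x y | ladj b x y]
  else false.

Lemma apex_verts t : apex t \in verts t.
Proof. by elim: t => [x|a IHa b _] /=; rewrite ?inE // mem_cat IHa. Qed.

Lemma size_verts_gt0 t : 0 < size (verts t).
Proof. by have := apex_verts t; case: (verts t). Qed.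

Lemma linkC u v x y : link u v x y = link u v y x.
Proof. by rewrite /link orbC andbC [(x == u) && _]andbC. Qed.

Lemma linkCl u v x y : link u v x y = link v u x y.
Proof. by rewrite /link orbC. Qed.

Lemma ladj_sym t : symmetric (ladj t).
Proof. by elim: t => //= a IHa b IHb x y; rewrite linkC IHa IHb. Qed.

Lemma ladj_verts t x y : ladj t x y -> (x \in verts t) && (y \in verts t).
Proof.
elim: t => //= a IHa b IHb; rewrite !mem_cat /link.
case/or3P => [/orP[] /andP[/eqP-> /eqP->]|/IHa/andP[-> ->]|/IHb/andP[-> ->]] //;
  by rewrite ?apex_verts ?orbT.
Qed.

Lemma uniq_Graft a b : uniq (verts (Graft a b)) ->
  [/\ uniq (verts a), uniq (verts b), {in verts b, forall x, x \notin verts a}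
    & apex a != apex b].
Proof.
rewrite /= cat_uniq => /and3P[ua /hasPn dis ub]; split=> //.
apply/eqP => e; have := dis _ (apex_verts b).
by rewrite -e /= apex_verts.
Qed.

Lemma ladj_irrefl t : uniq (verts t) -> irreflexive (ladj t).
Proof.
elim: t => //= a IHa b IHb /uniq_Graft[ua ub _ ne] x.
rewrite IHa // IHb // !orbF /link; apply/negP.
by case/orP => /andP[/eqP-> /eqP e]; rewrite e eqxx in ne.
Qed.

Definition decomposes (G : rel V) t :=
  [/\ uniq (verts t), (forall x, x \in verts t) & ladj t =2 G].

(** Adds a leaf [w] below an arbitrary vertex [u], whereas [Graft] only acts at
    the root. *)
Fixpoint attach u w t :=
  match t with
  | Vertex x => if x == u then Graft (Vertex x) (Vertex w) else Vertex x
  | Graft a b => Graft (attach u w a) (attach u w b)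
  end.

Lemma apex_attach u w t : apex (attach u w t) = apex t.
Proof. by elim: t => //= x; case: eqP. Qed.

Lemma attach_notin u w t : u \notin verts t -> attach u w t = t.
Proof.
elim: t => [x|a IHa b IHb] /=; first by rewrite inE eq_sym => /negPf->.
by rewrite mem_cat negb_or => /andP[/IHa-> /IHb->].
Qed.

Lemma verts_attach u w t : uniq (verts t) -> u \in verts t ->
  perm_eq (verts (attach u w t)) (w :: verts t).
Proof.
elim: t => [x|a IHa b IHb]; first by
  rewrite /= inE eq_sym => _ ->; rewrite (perm_catC [:: x] [:: w]).
move=> /uniq_Graft[ua ub dis _] /=; rewrite mem_cat => /orP[ina|inb].
  rewrite (@attach_notin _ _ b); last by apply: contraL ina => /dis.
  by rewrite -cat_cons perm_cat2r IHa.
rewrite (attach_notin _ (dis _ inb)).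
by rewrite perm_sym -cat1s perm_catCA perm_cat2l perm_sym IHb.
Qed.

Lemma ladj_attach u w t x y : uniq (verts t) -> u \in verts t ->
  ladj (attach u w t) x y = link u w x y || ladj t x y.
Proof.
elim: t => [z|a IHa b IHb].
  by rewrite /= inE eq_sym => _ /eqP->; rewrite eqxx /=.
move=> /uniq_Graft[ua ub dis _] /=; rewrite mem_cat !apex_attach => /orP[ina|inb].
  rewrite (@attach_notin _ _ b); last by apply: contraL ina => /dis.
  by rewrite IHa // -!orbA; do !bool_congr.
by rewrite (attach_notin _ (dis _ inb)) IHb // -!orbA; do !bool_congr.
Qed.

End RTree.

Lemma connect_apex (V : finType) (t : rtree V) x :
  x \in verts t -> connect (ladj t) (apex t) x.
Proof.
elim: t x => [y|a IHa b IHb] x /=; first by rewrite inE => /eqP->; apply: connect0.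
rewrite mem_cat => /orP[/IHa|/IHb] c.
  apply: connect_sub c => u v e; apply: connect1 => /=; by rewrite e orbT.
have ab : ladj (Graft a b) (apex a) (apex b) by rewrite /= /link !eqxx.
apply: connect_trans (connect1 ab) _.
apply: connect_sub c => u v e; apply: connect1 => /=; by rewrite e !orbT.
Qed.

(** The path between two neighbours of [w] inside [t] would close up to a cycle
    through [w]. *)
Lemma tree_unique_neighbour (G : sgraph) (t : rtree G) u v w :
  acyclic G -> {in verts t &, ladj t =2 @adj G} -> w \notin verts t ->
  u \in verts t -> v \in verts t -> adj w u -> adj w v -> u = v.
Proof.
move=> acy tadj wt ut vt wu wv; apply/eqP/negPn/negP => neq.
have csym : connect_sym (ladj t).
  by apply: (@sym_connect_sym G (ladj t)); apply: ladj_sym.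
have : connect (ladj t) u v.
  by apply: connect_trans (connect_apex vt); rewrite csym connect_apex.
case/connectP => p pth lst; case: (shortenP pth) lst => q qpth qu _ lst.
have inverts y : y \in q -> y \in verts t.
  elim: (q) (u) qpth => //= z r IHr x /andP[/ladj_verts/andP[_ zt] pr].
  by rewrite inE => /predU1P[->//|]; apply: IHr pr.
have qadj : path (@adj G) u q.
  elim: (q) (u) ut qpth => //= z r IHr x xt /andP[xz pr].
  have /andP[_ zt] := ladj_verts xz.
  by rewrite -tadj // xz IHr.
apply: (acy [:: w, u & q]).
  by case: (q) lst => //= e; rewrite e eqxx in neq.
apply/andP; split; last first.
  rewrite cons_uniq qu andbT inE negb_or; apply/andP; split.
    by apply: contraNneq wt => ->.
  by apply: contra wt => /inverts.
by rewrite /cycle rcons_path /= wu qadj -lst adj_sym wv.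
Qed.

(** A decomposition is grown inside the graph leaf by leaf: connectedness gives
    an edge leaving the part already covered, and acyclicity makes its outer
    end a leaf of the enlarged part. *)
Lemma tree_decomposes (G : sgraph) :
  is_tree G -> exists t : rtree G, decomposes (@adj G) t.
Proof.
case=> /card_gt0P[r _] conn acy.
suff [t [ut tadj full]] : exists t : rtree G, [/\ uniq (verts t),
    {in verts t &, ladj t =2 @adj G}
  & (forall x, x \in verts t) \/ #|G| < size (verts t)].
  have {}full x : x \in verts t.
    case: full => [->//|]; rewrite -(card_uniqP ut) ltnNge.
    by rewrite max_card.
  by exists t; split=> // x y; apply: tadj.
elim: #|G| => [|n [t [ut tadj full]]].
  exists (Vertex r); split=> //; last by right.
  by move=> x y; rewrite !inE => /eqP-> /eqP->; rewrite adj_irrefl.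
have [allt|/forallPn[z zt]] := altP (@forallP G (fun x => x \in verts t)).
  by exists t; split=> //; left.
case: full => [full|ltn]; first by rewrite full in zt.
have [u ut' [w wt uw]] : exists2 u, u \in verts t &
    exists2 w, w \notin verts t & adj u w.
  have /connectP[p] := conn (apex t) z.
  elim: p (apex t) (apex_verts t) => [|y p IHp] x xt /=.
    by move=> _ ez; rewrite ez xt in zt.
  case/andP => xy pth lst; have [yt|yt] := boolP (y \in verts t).
    exact: IHp yt pth lst.
  by exists x => //; exists y.
have pv := verts_attach w ut ut'; exists (attach u w t); split.
- by rewrite (perm_uniq pv) /= wt.
- move=> x y; rewrite !(perm_mem pv) !inE ladj_attach // /link.
  have notw v : ladj t w v = false.
    by apply/negP => /ladj_verts; rewrite (negPf wt).
  have onlyu v : v \in verts t -> adj w v = (v == u).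
    move=> vt; apply/idP/eqP => [wv|->]; last by rewrite adj_sym.
    by apply: (tree_unique_neighbour acy tadj wt); rewrite // adj_sym.
  have wneu : (w == u) = false by apply: contraNF wt => /eqP->.
  have [->|xw] := eqVneq x w; have [->|yw] := eqVneq y w.
  + by rewrite notw adj_irrefl wneu.
  + by move=> _ /= yt; rewrite onlyu // andbF notw orbF.
  + by move=> /= xt _; rewrite ladj_sym notw adj_sym onlyu // !orbF andbT.
  + by rewrite !andbF /=; apply: tadj.
- by right; rewrite (perm_size pv).
Qed.

(** * Cost profiles of rooted trees *)

(** A vertex [x] with strength [h] hears a broadcast that could still travel
    [h - 1] steps further; thus every vertex needs strength at least 1, and a
    vertex of cost [c > 0] has strength at most [c + 1].  The boolean
    of a signal tells whether the strength of the root is already explained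
    inside the tree, or has to come from a stronger neighbour outside. *)
Definition signal := (nat * bool)%type.

Definition signals : seq signal :=
  [:: (3, true); (2, true); (1, true); (2, false); (1, false)].

(** An explained root of larger strength can replace any signal of at most its
    strength; an unexplained one cannot, because a larger strength also asks
    for a stronger neighbour. *)
Definition le_signal (s s' : signal) := (s == s') || s'.2 && (s.1 <= s'.1).

(** In [Graft a b] the root of [b] has no neighbour left to come, so the root
    of [a] is its last chance to be explained. *)
Definition compatible (s1 s2 : signal) := s2.2 || (s2.1 < s1.1).

Definition graft_signal (s1 s2 : signal) : signal :=
  (s1.1, s1.2 || (s1.1 < s2.1)).

(** Signals may be overachieved, which is what keeps the tables small. *)
Lemma graft_signal_le s1 s2 s1' s2' :
  compatible s1 s2 -> le_signal s1 s1' -> le_signal s2 s2' ->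
  compatible s1' s2' && le_signal (graft_signal s1 s2) (graft_signal s1' s2').
Proof.
rewrite /compatible /le_signal /graft_signal.
case: s1 s2 s1' s2' => [h1 j1] [h2 j2] [h1' j1'] [h2' j2'] /=.
rewrite !xpair_eqE => comp le1 le2.
by case: j1 j2 j1' j2' comp le1 le2 => [] [] [] [] /=; lia.
Qed.

(** Indexed by [signals]; the entry for [s] bounds 9 times the weight minus 4
    times the number of vertices. *)
Definition profile := seq int.

Definition bound (p : profile) (s : signal) : int := nth 0%R p (index s signals).

(** A decidable certificate that [r] is at least the min-plus product of [p] and
    [q]. *)
Definition covers (p q r : profile) :=
  all (fun s => has (fun s12 =>
      [&& compatible s12.1 s12.2, le_signal s (graft_signal s12.1 s12.2)
        & (bound p s12.1 + bound q s12.2 <= bound r s)%R])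
    [seq (s1, s2) | s1 <- signals, s2 <- signals]) signals.

Section Plans.
Variable V : eqType.
Implicit Types (a b t : rtree V) (f h : V -> nat) (s : signal).

Definition heard t f h x :=
  (0 < f x) && (h x <= (f x).+1) \/ (exists2 y, ladj t x y & h x < h y).

(** A plan certifies domination locally: following the neighbours of increasing
    strength leads to a vertex that broadcasts far enough. *)
Definition plan t f h s :=
  [/\ {in verts t, forall x, f x <= 2 /\ 0 < h x <= 3},
      {in verts t, forall x, (x != apex t) || s.2 -> heard t f h x}
    & h (apex t) = s.1].

Definition weight t f := \sum_(x <- verts t) f x.

Definition admits t (p : profile) := forall s, s \in signals ->
  exists f h s', [/\ plan t f h s', le_signal s s'
    & ((9 * weight t f)%:Z <= (4 * size (verts t))%:Z + bound p s)%R].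

Definition glue a (f g : V -> nat) x := if x \in verts a then f x else g x.

(** Only the two roots gain a neighbour, so the explanations of all other
    vertices carry over. *)
Lemma plan_Graft a b f1 h1 s1 f2 h2 s2 :
  uniq (verts (Graft a b)) -> plan a f1 h1 s1 -> plan b f2 h2 s2 ->
  compatible s1 s2 ->
  plan (Graft a b) (glue a f1 f2) (glue a h1 h2) (graft_signal s1 s2).
Proof.
move=> /uniq_Graft[_ _ dis _] [r1 v1 e1] [r2 v2 e2] comp.
have gl g g' x : x \in verts a -> glue a g g' x = g x by rewrite /glue => ->.
have gr g g' x : x \in verts b -> glue a g g' x = g' x.
  by rewrite /glue => /dis/negPf->.
split; last by rewrite /= gl ?apex_verts.
  by move=> x /=; rewrite mem_cat => /orP[xa|xb];
    [rewrite !gl //; apply: r1 | rewrite !gr //; apply: r2].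
move=> x /=; rewrite mem_cat => /orP[xa|xb].
  have [->|nr] := eqVneq x (apex a); last first.
    (* Vertices other than the roots keep their explanation. *)
    move=> _; have [|hx|[y xy lt]] := v1 x xa; first by rewrite nr.
      by left; rewrite !gl.
    have /andP[_ ya] := ladj_verts xy.
    by right; exists y; rewrite ?gl //= xy orbT.
  (* The root of [a] is explained inside [a], or now by the root of [b]. *)
  move=> /= /orP[j1|lt]; last first.
    right; exists (apex b); first by rewrite /= /link !eqxx.
    by rewrite gl ?apex_verts // gr ?apex_verts // e1 e2.
  have [|hx|[y xy lt]] := v1 (apex a) (apex_verts a); first by rewrite j1 orbT.
    by left; rewrite !gl ?apex_verts.
  have /andP[_ ya] := ladj_verts xy.
  by right; exists y; rewrite ?gl ?apex_verts //= xy orbT.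
move=> _; have [bad|ok] := boolP ((x == apex b) && ~~ s2.2); last first.
  have [|hx|[y xy lt]] := v2 x xb.
  - by rewrite negb_and negbK in ok.
  - by left; rewrite !gr.
  - have /andP[_ yb] := ladj_verts xy.
    by right; exists y; rewrite ?gr //= xy !orbT.
move: bad => /andP[/eqP-> nj2]; right; exists (apex a).
  by rewrite ladj_sym /= /link !eqxx.
rewrite gr ?apex_verts // gl ?apex_verts // e1 e2.
by move: comp; rewrite /compatible (negPf nj2).
Qed.

Lemma weight_Graft a b f g : uniq (verts (Graft a b)) ->
  weight (Graft a b) (glue a f g) = weight a f + weight b g.
Proof.
move=> /uniq_Graft[_ _ dis _]; rewrite /weight /= big_cat /=; congr addn.
  by apply: eq_big_seq => x xa; rewrite /glue xa.
by apply: eq_big_seq => x /dis/negPf xa; rewrite /glue xa.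
Qed.

Lemma admits_Graft a b p q r :
  uniq (verts (Graft a b)) -> covers p q r -> admits a p -> admits b q ->
  admits (Graft a b) r.
Proof.
move=> uab cov adma admb s ss.
have /allP/(_ s ss)/hasP[[s1 s2] in12 /and3P[/= comp le12 le_r]] := cov.
have {in12} [ss1 ss2] : s1 \in signals /\ s2 \in signals.
  by case/allpairsP: in12 => [[u v] /= [? ? [-> ->]]].
have [f1 [h1 [s1' [plan1 le1 w1]]]] := adma _ ss1.
have [f2 [h2 [s2' [plan2 le2 w2]]]] := admb _ ss2.
have /andP[comp' le12'] := graft_signal_le comp le1 le2.
exists (glue a f1 f2), (glue a h1 h2), (graft_signal s1' s2'); split.
- exact: plan_Graft.
- move: le12 le12'; rewrite /le_signal => /orP[/eqP->//|].
  move=> /andP[j le] /orP[/eqP<-|/andP[-> le']]; first by rewrite j le orbT.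
  by rewrite (leq_trans le le') orbT.
- by rewrite weight_Graft //= size_cat; lia.
Qed.

Lemma admits_Vertex x : admits (Vertex x) [:: 14; 5; 5; -4; -4]%Z.
Proof.
move=> s; rewrite !inE.
pose c (k : nat) := fun _ : V => k.
have planc (k h : nat) (j : bool) : k <= 2 -> 0 < h <= 3 ->
    (j -> (0 < k) && (h <= k.+1)) ->
    plan (Vertex x) (c k) (c h) (h, j).
  move=> k2 h3 jk; split=> // y; rewrite inE => /eqP->.
  by rewrite eqxx => /jk ?; left.
have wc (k : nat) : weight (Vertex x) (c k) = k by rewrite /weight /= big_seq1.
case/or4P => [|||/orP[]] /eqP->.
(* (1, true) is overachieved by (2, true): cost 1 already gives strength 2. *)
- by exists (c 2), (c 3), (3, true); rewrite wc; split=> //; apply: planc.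
- by exists (c 1), (c 2), (2, true); rewrite wc; split=> //; apply: planc.
- by exists (c 1), (c 2), (2, true); rewrite wc; split=> //; apply: planc.
- by exists (c 0), (c 2), (2, false); rewrite wc; split=> //; apply: planc.
- by exists (c 0), (c 1), (1, false); rewrite wc; split=> //; apply: planc.
Qed.

End Plans.

Lemma size_decomposes (V : finType) (e : rel V) t :
  decomposes e t -> size (verts t) = #|V|.
Proof.
by case=> ut full _; rewrite -(card_uniqP ut); apply: eq_card => x; rewrite full.
Qed.

Lemma sum_decomposes (V : finType) (e : rel V) t (F : V -> nat) :
  decomposes e t -> \sum_x F x = \sum_(x <- verts t) F x.
Proof.
by case=> ut full _; rewrite [RHS]big_uniq //=; apply: eq_bigl => x; rewrite full.
Qed.

(** Strengths are at most 3, so the chain of increasing strengths from a vertex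
    stops after at most two steps, at a vertex whose cost is at least the
    length of the chain. *)
Lemma plan_dominating (G : sgraph) (t : rtree G) f h s :
  decomposes (@adj G) t -> plan t f h s -> s.2 ->
  gamma_B2 G <= weight t f.
Proof.
move=> dt [range ok _] js; have [ut full tadj] := dt.
have hear n x : 3 - h x <= n -> exists v k,
    [/\ walk_of_length k x v, 0 < f v & h x + k <= (f v).+1].
  elim: n x => [|n IHn] x le_n.
    have [|/andP[f0 le]|[y xy lt]] := ok x (full x); first by rewrite js orbT.
      by exists x, 0; split=> //; [apply/walkP; exists [::] | rewrite addn0].
    by have [_] := range y (full y); lia.
  have [|/andP[f0 le]|[y xy lt]] := ok x (full x); first by rewrite js orbT.
    by exists x, 0; split=> //; [apply/walkP; exists [::] | rewrite addn0].
  have [|v [k [w f0 le]]] := IHn y; first by lia.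
  exists v, k.+1; split=> //; last by lia.
  case/walkP: w => p [pth lst <-]; apply/walkP; exists (y :: p).
  by rewrite /= -tadj xy.
pose F := [ffun x => inord (f x) : 'I_3].
have FE x : F x = f x :> nat.
  by rewrite ffunE inordK // ltnS; have [] := range x (full x).
have dF : dominating F.
  apply/forallP => u; have [v [k [w f0 le]]] := hear _ u (leqnn _).
  apply/existsP; exists v; rewrite !FE f0 /=.
  apply: leq_trans (gdist_le_walk w) _.
  by have [_] := range u (full u); lia.
apply: leq_trans (gamma_B2_le dF) _; apply: eq_leq.
rewrite /cost /weight -(sum_decomposes f dt); apply: eq_bigr => x _; exact: FE.
Qed.

Lemma admits_gamma_B2 (G : sgraph) (t : rtree G) p :
  decomposes (@adj G) t -> admits t p ->
  ((9 * gamma_B2 G)%:Z <= (4 * #|G|)%:Z + bound p (1%N, true))%R.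
Proof.
move=> dt /(_ (1, true))[//|f [h [s [pl le w]]]].
have js : s.2 by move: le => /orP[/eqP<-|/andP[]].
by have := plan_dominating dt pl js; have := size_decomposes dt; lia.
Qed.

(** * Rooted trees that are not cheap *)

Section Shapes.
Variable V : eqType.
Implicit Types (a b t u : rtree V) (x y z w : V).

(** Labels are kept, so that reordering children or rerooting relates two
    descriptions of one subgraph, without isomorphisms. *)
Definition same_tree a b := perm_eq (verts a) (verts b) /\ ladj a =2 ladj b.

Definition same_rooted a b := apex a = apex b /\ same_tree a b.

Lemma same_rooted_refl t : same_rooted t t.
Proof. by []. Qed.

Lemma same_tree_trans a b t : same_tree a b -> same_tree b t -> same_tree a t.
Proof.
by case=> p1 e1 [p2 e2]; split; [apply: perm_trans p2|move=> x y; rewrite e1].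
Qed.

Lemma same_rooted_trans a b t :
  same_rooted a b -> same_rooted b t -> same_rooted a t.
Proof.
by case=> e1 s1 [e2 s2]; split; [rewrite e1|apply: same_tree_trans s2].
Qed.

Lemma same_rooted_Graft a b a' b' :
  same_rooted a a' -> same_rooted b b' -> same_rooted (Graft a b) (Graft a' b').
Proof.
case=> ra [pa ea] [rb [pb eb]]; split=> //; split; first exact: perm_cat.
by move=> x y; rewrite /= ra rb ea eb.
Qed.

Lemma same_rooted_swap a b t :
  same_rooted (Graft (Graft a b) t) (Graft (Graft a t) b).
Proof.
split=> //; split; first by rewrite /= perm_catAC.
by move=> x y /=; rewrite -!orbA; do !bool_congr.
Qed.

Lemma same_tree_flip a b : same_tree (Graft a b) (Graft b a).
Proof.
split; first by rewrite /= perm_catC.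
by move=> x y /=; rewrite linkCl; do !bool_congr.
Qed.

Definition edge_tree x y := Graft (Vertex x) (Vertex y).

(** The path x-y-z-w, rooted at its internal vertex [y]. *)
Definition P4_tree x y z w := Graft (edge_tree y x) (edge_tree z w).

Definition inner_P4 t := exists x y z w, same_rooted t (P4_tree x y z w).

(** [center k t]: the root of [t] is the centre of a copy of T_9 of which [k]
    copies of P_4 are already grafted, together with any number of members of
    the family, each by its central vertex; so [center 2] describes the family
    rooted at one of these centres. *)
Inductive center : nat -> rtree V -> Prop :=
| center_vertex x : center 0 (Vertex x)
| center_P4 k t p : center k t -> inner_P4 p -> center k.+1 (Graft t p)
| center_family k t u : center k t -> center 2 u -> center k (Graft t u).

Definition family_tree t := exists2 u, center 2 u & same_tree t u.

(** Below, a copy of P_4 in T_9 has vertices a-b-c-d, with b next to the centre;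
    the subtree at the centre ([center 1]) contains the other copy.  The names
    [b], [ba], [bcd], [cba] list the vertices of this copy present in the
    piece, the root first, and [inner] and [leaf] are complete members of the
    family rooted at b or c, respectively at a or d.  Rerooting makes these
    members of [family_tree], which is all that is recorded of them.
    The profile of a constructor is that of the smallest tree it describes;
    further members of the family hanging on a centre do not raise it. *)
Inductive extremal : rtree V -> profile -> Prop :=
| extremal_vertex x : extremal (Vertex x) [:: 14; 5; 5; -4; -4]%Z
| extremal_edge x y : extremal (edge_tree x y) [:: 10; 1; 1; -8; 1]%Z
| extremal_P3 x y z :
    extremal (Graft (Vertex x) (edge_tree y z)) [:: 6; 6; -3; -3; -3]%Z
| extremal_P4_end x y z w :
    extremal (Graft (Vertex x) (Graft (Vertex y) (edge_tree z w)))
      [:: 11; 2; 2; -7; -7]%Z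
| extremal_P4_inner t : inner_P4 t -> extremal t [:: 2; 2; 2; -7; 2]%Z
| extremal_center0 t u : center 0 t -> center 2 u ->
    extremal (Graft t u) [:: 14; -4; -4; -4; -4]%Z
| extremal_center1 t : center 1 t -> extremal t [:: 7; -2; -2; -2; -2]%Z
| extremal_center2 t : center 2 t -> extremal t [:: 0; 0; 0; 0; 0]%Z
| extremal_b x t : center 1 t ->
    extremal (Graft (Vertex x) t) [:: 12; 3; -6; -6; -6]%Z
| extremal_ba x y t u : center 1 u ->
    same_rooted t (Graft (edge_tree x y) u) ->
    extremal t [:: 8; -1; -1; -10; -1]%Z
| extremal_bcd x y z t u : center 1 u ->
    same_rooted t (Graft (Graft (Vertex x) (edge_tree y z)) u) ->
    extremal t [:: 4; 4; -5; -5; -5]%Z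
| extremal_cba x y z t u : center 1 u ->
    same_rooted t (Graft (edge_tree x y) u) ->
    extremal (Graft (Vertex z) t) [:: 4; 4; -5; -5; -5]%Z
| extremal_inner t : family_tree t -> extremal t [:: 0; 0; 0; -9; 0]%Z
| extremal_leaf t : family_tree t -> extremal t [:: 9; 0; 0; -9; -9]%Z.

(** The maximal profiles among the rooted trees that are not pieces of a tight
    tree, found by enumerating small trees. *)
Definition slack_profiles : seq profile :=
  [:: [:: 7; -2; -2; -11; -2]; [:: 3; 3; -6; -6; -6]; [:: 8; -1; -1; -10; -10];
      [:: -1; -1; -1; -1; -1]; [:: 13; -5; -5; -5; -5]; [:: 6; -3; -3; -3; -3];
      [:: 11; 2; -7; -7; -7]]%Z.

Definition extremal_profiles : seq profile :=
  [:: [:: 14; 5; 5; -4; -4]; [:: 10; 1; 1; -8; 1]; [:: 6; 6; -3; -3; -3];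
      [:: 11; 2; 2; -7; -7]; [:: 2; 2; 2; -7; 2]; [:: 14; -4; -4; -4; -4];
      [:: 7; -2; -2; -2; -2]; [:: 0; 0; 0; 0; 0]; [:: 12; 3; -6; -6; -6];
      [:: 8; -1; -1; -10; -1]; [:: 4; 4; -5; -5; -5]; [:: 0; 0; 0; -9; 0];
      [:: 9; 0; 0; -9; -9]]%Z.

Lemma extremal_profilesP t p : extremal t p -> p \in extremal_profiles.
Proof. by case. Qed.

Lemma slack_absorbs : {in slack_profiles & slack_profiles ++ extremal_profiles,
  forall p q, has (covers p q) slack_profiles && has (covers q p) slack_profiles}.
Proof.
have /allP chk : all (fun p => all (fun q =>
    has (covers p q) slack_profiles && has (covers q p) slack_profiles)
  (slack_profiles ++ extremal_profiles)) slack_profiles by vm_compute.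
by move=> p q /chk/allP; apply.
Qed.

Lemma family_flip a b : family_tree (Graft a b) -> family_tree (Graft b a).
Proof.
case=> u cu s; exists u => //; apply: same_tree_trans s; exact: same_tree_flip.
Qed.

Lemma family_same_rooted a b : same_rooted a b -> family_tree b -> family_tree a.
Proof. by case=> _ s [u cu s']; exists u => //; apply: same_tree_trans s'. Qed.

Lemma family_P4 p u : inner_P4 p -> center 1 u -> family_tree (Graft p u).
Proof.
move=> ip cu; apply: family_flip; exists (Graft u p) => //.
exact: center_P4.
Qed.

(** The next three lemmas complete a copy of P_4 in the three orders in which
    its last vertex or edge can arrive; reordering or rerooting exhibits the
    full copy hanging on the centre. *)
Lemma family_bacd x y z w t u : center 1 u ->
  same_rooted t (Graft (edge_tree x y) u) ->
  family_tree (Graft t (edge_tree z w)).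
Proof.
move=> cu st.
apply: family_same_rooted (same_rooted_Graft st (same_rooted_refl _)) _.
apply: family_same_rooted (same_rooted_swap _ _ _) _.
by apply: family_P4 cu; exists y, x, z, w.
Qed.

Lemma family_bcda x y z w t u : center 1 u ->
  same_rooted t (Graft (Graft (Vertex x) (edge_tree y z)) u) ->
  family_tree (Graft t (Vertex w)).
Proof.
move=> cu st.
apply: family_same_rooted (same_rooted_Graft st (same_rooted_refl _)) _.
apply: family_same_rooted (same_rooted_swap _ _ _) _.
apply: family_P4 cu; exists w, x, y, z; exact: same_rooted_swap.
Qed.

Lemma family_cbad x y z w t u : center 1 u ->
  same_rooted t (Graft (edge_tree x y) u) ->
  family_tree (Graft (Graft (Vertex z) t) (Vertex w)).
Proof.
move=> cu st; apply: family_same_rooted (same_rooted_swap _ _ _) _.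
by apply: family_flip; apply: family_bacd cu st.
Qed.

Lemma inner_P4_edges x y z w : inner_P4 (Graft (edge_tree x y) (edge_tree z w)).
Proof. by exists y, x, z, w. Qed.

Lemma inner_P4_bcda x y z w :
  inner_P4 (Graft (Graft (Vertex x) (edge_tree y z)) (Vertex w)).
Proof. exists w, x, y, z; exact: same_rooted_swap. Qed.

Lemma same_rooted_swap_edge x y t :
  same_rooted (Graft (Graft (Vertex x) t) (Vertex y)) (Graft (edge_tree x y) t).
Proof. exact: same_rooted_swap. Qed.

Local Hint Constructors center : core.
Local Hint Resolve inner_P4_edges inner_P4_bcda same_rooted_refl : core.
Local Hint Resolve same_rooted_swap same_rooted_swap_edge : core.
Local Hint Resolve family_P4 family_bacd : core.
Local Hint Resolve family_bcda family_cbad : core.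
Local Hint Extern 4 (family_tree (Graft (Vertex _) _)) =>
  apply: family_flip : core.
Local Hint Extern 4 (family_tree (Graft (edge_tree _ _) _)) =>
  apply: family_flip : core.

(* The constructor determines the profile, which is then checked against the
   product. *)
Ltac extremal_by C :=
  eexists; last (by eapply C; eauto); vm_compute; reflexivity.

Lemma extremal_Graft a b p q : extremal a p -> extremal b q ->
  has (covers p q) slack_profiles \/
  exists2 r, covers p q r & extremal (Graft a b) r.
Proof.
case=> *; match goal with H : extremal b q |- _ => case: H end => *;
  try (left; vm_compute; reflexivity); right.
- extremal_by extremal_edge.
- extremal_by extremal_P3.
- extremal_by extremal_P4_end.
- extremal_by extremal_center1.
- extremal_by extremal_b.
- extremal_by extremal_center0.
- extremal_by extremal_cba.
- extremal_by extremal_leaf.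
- extremal_by extremal_leaf.
- extremal_by extremal_P4_inner.
- extremal_by extremal_ba.
- extremal_by extremal_inner.
- extremal_by extremal_P4_inner.
- extremal_by extremal_bcd.
- extremal_by extremal_inner.
- extremal_by extremal_center1.
- extremal_by extremal_center0.
- extremal_by extremal_center2.
- extremal_by extremal_center1.
- extremal_by extremal_center2.
- extremal_by extremal_ba.
- extremal_by extremal_bcd.
- extremal_by extremal_inner.
- extremal_by extremal_inner.
- extremal_by extremal_inner.
Qed.

(** Slack absorbs, and two extremal trees yield a slack tree or an extremal
    one. *)
Theorem classification t : uniq (verts t) ->
  (exists2 p, p \in slack_profiles & admits t p) \/
  (exists2 p, extremal t p & admits t p).
Proof.
elim: t => [x _|a IHa b IHb uab].
  by right; exists [:: 14; 5; 5; -4; -4]%Z; [constructor|apply: admits_Vertex].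
have slack p q : has (covers p q) slack_profiles -> admits a p -> admits b q ->
    exists2 p, p \in slack_profiles & admits (Graft a b) p.
  by case/hasP=> r rs cov ha hb; exists r => //; apply: admits_Graft ha hb.
have [ua ub _ _] := uniq_Graft uab.
have [[p ps ha]|[p ep ha]] := IHa ua; have [[q qs hb]|[q eq hb]] := IHb ub.
- left; apply: slack ha hb; have := slack_absorbs ps (_ : q \in _).
  by rewrite mem_cat qs => /(_ isT)/andP[].
- left; apply: slack ha hb; have := slack_absorbs ps (_ : q \in _).
  by rewrite mem_cat (extremal_profilesP eq) orbT => /(_ isT)/andP[].
- left; apply: slack ha hb; have := slack_absorbs qs (_ : p \in _).
  by rewrite mem_cat (extremal_profilesP ep) orbT => /(_ isT)/andP[].
- have [/slack|[r cov er]] := extremal_Graft ep eq; first by left; auto.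
  by right; exists r => //; apply: admits_Graft ha hb.
Qed.
End Shapes.

(** The largest entry for the signal [(1, true)] is 5, that of a single
    vertex. *)
Lemma gamma_B2_lt (G : sgraph) (t : rtree G) :
  decomposes (@adj G) t -> 9 * gamma_B2 G < 4 * #|G| + 9.
Proof.
move=> dt; have [ut _ _] := dt.
have {ut}[p ps ad] : exists2 p, p \in slack_profiles ++ extremal_profiles &
    admits t p.
  have [[p ps ad]|[p /extremal_profilesP ps ad]] := classification ut;
    by exists p; rewrite // mem_cat ps ?orbT.
have p5 : (bound p (1%N, true) <= 5)%R by move: p ps {ad}; apply/allP; vm_compute.
by have := admits_gamma_B2 dt ad; lia.
Qed.

Lemma gamma_B2_extremal (G : sgraph) (t : rtree G) :
  decomposes (@adj G) t -> 4 * #|G| <= 9 * gamma_B2 G ->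
  [\/ exists x, same_tree t (Vertex x), exists x y, same_tree t (edge_tree x y),
      exists x y z w, same_tree t (P4_tree x y z w) | family_tree t].
Proof.
move=> dt ge; have [ut _ _] := dt.
have [[p ps ad]|[p ep ad]] := classification ut.
  have p0 : (bound p (1%N, true) < 0)%R by move: p ps {ad}; apply/allP; vm_compute.
  by have := admits_gamma_B2 dt ad; lia.
have {ad} : (0 <= bound p (1%N, true))%R.
  by have := admits_gamma_B2 dt ad; lia.
case: ep => {dt ge ut t p} //=.
- by move=> x _; apply: Or41; exists x.
- by move=> x y _; apply: Or42; exists x, y.
- move=> x y z w _; apply: Or43; exists x, y, z, w.
  apply: same_tree_trans (same_tree_flip _ _) _.
  exact: (same_rooted_swap (Vertex y) (edge_tree z w) (Vertex x)).2.
- by move=> t [x [y [z [w [_ s]]]]] _; apply: Or43; exists x, y, z, w.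
- by move=> t ct _; apply: Or44; exists t.
- by move=> t ft _; apply: Or44.
- by move=> t ft _; apply: Or44.
Qed.

(** * From rooted trees back to graphs *)

Fixpoint rmap (I V : Type) (g : I -> V) (s : rtree I) : rtree V :=
  match s with
  | Vertex i => Vertex (g i)
  | Graft a b => Graft (rmap g a) (rmap g b)
  end.

Lemma rmap_comp (I J V : Type) (g : J -> V) (h : I -> J) s :
  rmap g (rmap h s) = rmap (g \o h) s.
Proof. by elim: s => //= a -> b ->. Qed.

Lemma rmap_id_in (I : eqType) (f : I -> I) s :
  {in verts s, forall i, f i = i} -> rmap f s = s.
Proof.
elim: s => [x|a IHa b IHb] /= fK; first by rewrite fK ?inE.
by rewrite IHa ?IHb // => i ins; apply: fK; rewrite mem_cat ins ?orbT.
Qed.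

Section Rmap.
Variables (I V : eqType) (g : I -> V).
Implicit Types s : rtree I.

Lemma apex_rmap s : apex (rmap g s) = g (apex s).
Proof. by elim: s. Qed.

Lemma verts_rmap s : verts (rmap g s) = map g (verts s).
Proof. by elim: s => //= a -> b ->; rewrite map_cat. Qed.

Lemma ladj_rmap s : {in verts s &, injective g} ->
  {in verts s &, forall i j, ladj (rmap g s) (g i) (g j) = ladj s i j}.
Proof.
move=> gI.
suff H s' : {subset verts s' <= verts s} ->
    {in verts s &, forall i j, ladj (rmap g s') (g i) (g j) = ladj s' i j}.
  exact: H.
elim: s' => //= a IHa b IHb sub i j si sj.
rewrite IHa ?IHb //; try by move=> k ks; apply: sub; rewrite mem_cat ks ?orbT.
have ina : apex a \in verts s by apply: sub; rewrite mem_cat apex_verts.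
have inb : apex b \in verts s by apply: sub; rewrite mem_cat apex_verts orbT.
by rewrite !apex_rmap /link !(inj_in_eq gI).
Qed.

End Rmap.

(** Equality of cardinals turns the labelling [g] into a bijection; it is
    injective since both decompositions list each vertex once. *)
Lemma rmap_isomorphic (G H : sgraph) (g : H -> G) s t :
  decomposes (@adj H) s -> decomposes (@adj G) t -> same_tree t (rmap g s) ->
  isomorphic G H.
Proof.
move=> ds dt [pt lt]; have [[us fs es] [ut _ et]] := (ds, dt).
have gI : injective g.
  apply/injectiveP; rewrite /injectiveb /dinjectiveb.
  have : perm_eq (enum H) (verts s).
    by apply: uniq_perm => // [|x]; rewrite ?enum_uniq // fs mem_enum.
  by move/(perm_map g)/perm_uniq->; rewrite -verts_rmap -(perm_uniq pt).
apply: isomorphic_sym; exists g.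
  apply: inj_card_bij gI _.
  rewrite -(size_decomposes dt) -(size_decomposes ds) (perm_size pt).
  by rewrite verts_rmap size_map.
move=> x y; rewrite -et lt ladj_rmap ?fs // ?es //.
by move=> i j _ _; apply: gI.
Qed.

(** The labels of [s], made into a type of their own, are the vertices of the
    graph that [s] decomposes. *)
Lemma rtree_graph (I : choiceType) (s : rtree I) : uniq (verts s) ->
  exists (Q : sgraph) (f : Q -> I) (s' : rtree Q),
    decomposes (@adj Q) s' /\ s = rmap f s'.
Proof.
move=> us.
pose W : finType := seq_sub (verts s).
pose g : I -> W := insubd (SeqSub (apex_verts s)).
have gK x : x \in verts s -> val (g x) = x by move=> xs; rewrite val_insubd xs.
pose s' := rmap g s.
have us' : uniq (verts s').
  rewrite verts_rmap map_inj_in_uniq // => x y xs ys e.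
  by rewrite -(gK x) // e gK.
exists (SGraph (@ladj_sym _ s') (ladj_irrefl us')), val, s'; split; last first.
  by rewrite /s' rmap_comp rmap_id_in.
split=> // x; rewrite verts_rmap; apply/mapP; exists (val x); first exact: valP.
by apply: val_inj; rewrite gK //; apply: valP.
Qed.

Lemma card_edges (Q : sgraph) s :
  decomposes (@adj Q) s -> #|edges Q| = #|Q| - 1.
Proof.
move=> ds; rewrite -(size_decomposes ds); case: ds => us _ es.
pose E s := [set [set p.1; p.2] | p : Q * Q & ladj s p.1 p.2].
have -> : edges Q = E s.
  by apply/setP => e; apply/imsetP/imsetP => -[p pe ->];
    exists p => //; move: pe; rewrite !inE es.
suff <- : #|E s| + 1 = size (verts s) by rewrite addnK.
have EP t e : reflect (exists x y, e = [set x; y] /\ ladj t x y) (e \in E t).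
  apply: (iffP imsetP) => [[[x y]]|[x [y [-> xy]]]].
    by rewrite inE /= => xy ->; exists x, y.
  by exists (x, y); rewrite ?inE.
have Everts t e x : e \in E t -> x \in e -> x \in verts t.
  by case/EP=> y [z [-> /ladj_verts/andP[yt zt]]] /set2P[]->.
elim: s us {es} => [x _|a IHa b IHb uab].
  rewrite (_ : E _ = set0) ?cards0 //.
  by apply/setP => e; rewrite inE; apply/EP => [[? [? []]]].
have [ua ub dis _] := uniq_Graft uab.
have -> : E (Graft a b) = [set apex a; apex b] |: (E a :|: E b).
  apply/setP => e; rewrite !inE; apply/EP/or3P.
    case=> x [y [-> /= /or3P[l|xy|xy]]].
    - apply: Or31; case/orP: l => /andP[/eqP-> /eqP->] //; by rewrite setUC.
    - by apply: Or32; apply/EP; exists x, y.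
    - by apply: Or33; apply/EP; exists x, y.
  case=> [/eqP->|/EP[x [y [-> xy]]]|/EP[x [y [-> xy]]]].
  - by exists (apex a), (apex b); rewrite /= /link !eqxx.
  - by exists x, y; rewrite /= xy orbT.
  - by exists x, y; rewrite /= xy !orbT.
rewrite cardsU1 /= size_cat.
have -> : [set apex a; apex b] \notin E a :|: E b.
  rewrite inE negb_or; apply/andP; split; apply/negP.
    move=> /Everts/(_ (set22 _ _)); apply/negP/dis; exact: apex_verts.
  by move=> /Everts/(_ (set21 _ _))/dis; rewrite apex_verts.
have -> : #|E a :|: E b| = #|E a| + #|E b|.
  rewrite cardsU (_ : _ :&: _ = set0) ?cards0 ?subn0 //.
  apply/setP => e; rewrite !inE; apply/negP => /andP[ea eb].
  have /EP[x [y [exy _]]] := ea; have xe : x \in e by rewrite exy set21.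
  by have := dis x (Everts _ _ _ eb xe); rewrite (Everts _ _ _ ea xe).
rewrite -(IHa ua) -(IHb ub) /=; move: #|E a| #|E b| => m n; lia.
Qed.

(** * The family in terms of rooted trees *)

(** Closed constants, so that adjacency in P_4 and T_9 is decided by
    computation. *)
Definition o0 : 'I_4 := @Ordinal 4 0 isT.
Definition o1 : 'I_4 := @Ordinal 4 1 isT.
Definition o2 : 'I_4 := @Ordinal 4 2 isT.
Definition o3 : 'I_4 := @Ordinal 4 3 isT.

Lemma ord4P (i : 'I_4) : [\/ i = o0, i = o1, i = o2 | i = o3].
Proof.
case: i => [[|[|[|[|//]]]] lt];
  by [apply: Or41; apply: val_inj | apply: Or42; apply: val_inj
     | apply: Or43; apply: val_inj | apply: Or44; apply: val_inj].
Qed.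

Definition P4_copy b : rtree T9 :=
  P4_tree (Some (b, o0)) (Some (b, o1)) (Some (b, o2)) (Some (b, o3)).

Definition T9_tree : rtree T9 :=
  Graft (Graft (Vertex T9_center) (P4_copy false)) (P4_copy true).

Lemma decomposes_path4 :
  decomposes (@adj (path_graph 4)) (P4_tree o0 o1 o2 o3).
Proof.
split=> [//|i|i j]; first by case: (ord4P i) => ->.
by case: (ord4P i) => ->; case: (ord4P j) => ->.
Qed.

Lemma decomposes_T9 : decomposes (@adj T9) T9_tree.
Proof.
split=> [//|[[[] i]|//]|[[b i]|] [[c j]|]//].
- by case: (ord4P i) => ->.
- by case: (ord4P i) => ->.
- by case: b c (ord4P i) (ord4P j) => [] [] [] -> [] ->.
- by case: b (ord4P i) => [] [] ->.
- by case: c (ord4P j) => [] [] ->.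
Qed.

(** The blow-up of [s]: each vertex becomes a copy of T_9, grafted by the
    centres; it decomposes [joinT9 Q] when [s] decomposes [Q]. *)
Fixpoint copies (I : Type) (s : rtree I) : rtree (I * T9) :=
  match s with
  | Vertex i => rmap (pair i) T9_tree
  | Graft a b => Graft (copies a) (copies b)
  end.

Lemma copies_rmap (I J : Type) (f : I -> J) s :
  copies (rmap f s) = rmap (fun p => (f p.1, p.2)) (copies s).
Proof. by elim: s => //= a -> b ->. Qed.

Section Copies.
Variable I : eqType.
Implicit Types s : rtree I.

Lemma apex_copies s : apex (copies s) = (apex s, T9_center).
Proof. by elim: s. Qed.

Lemma mem_copies s i k : ((i, k) \in verts (copies s)) = (i \in verts s).
Proof.
elim: s => [j|a IHa b IHb]; last by rewrite /= !mem_cat IHa IHb.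
have [_ full _] := decomposes_T9.
rewrite -[copies _]/(rmap (pair j) T9_tree) verts_rmap [in RHS]/= mem_seq1.
apply/mapP/eqP => [[l _ [-> _]]//|->].
by exists k.
Qed.

Lemma uniq_copies s : uniq (verts s) -> uniq (verts (copies s)).
Proof.
elim: s => [i _|a IHa b IHb /uniq_Graft[ua ub dis _]].
  have [u9 _ _] := decomposes_T9.
  by rewrite -[copies _]/(rmap (pair i) T9_tree) verts_rmap map_inj_uniq // => k l [].
rewrite /= cat_uniq IHa // IHb // andbT; apply/hasPn => -[i k].
by rewrite !mem_copies => /dis.
Qed.

Lemma ladj_copies s i j k l : ladj (copies s) (i, k) (j, l) =
  [&& i \in verts s, i == j & @adj T9 k l]
  || [&& k == T9_center, l == T9_center & ladj s i j].
Proof.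
elim: s => [q|a IHa b IHb]; last first.
  rewrite /= IHa IHb !apex_copies mem_cat /link !xpair_eqE.
  case: (k == _); case: (l == _); rewrite ?andbT ?andbF ?orbF /= andb_orl -?orbA;
    by do ?bool_congr.
have [_ full e9] := decomposes_T9; rewrite [ladj (Vertex q) _ _]/= !andbF orbF inE.
have [->|/negPf iq] := eqVneq i q; last first.
  apply/negP => /ladj_verts; rewrite !mem_copies inE iq.
  by [].
have [<-|/negPf jq] := eqVneq; last first.
  apply/negP => /ladj_verts; rewrite !mem_copies !inE [j == q]eq_sym jq.
  by rewrite andbF.
by rewrite -[copies _]/(rmap (pair q) T9_tree) ladj_rmap ?full // => ? ? _ _ [].
Qed.

End Copies.

Lemma decomposes_copies (Q : sgraph) s :
  decomposes (@adj Q) s -> decomposes (@adj (joinT9 Q)) (copies s).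
Proof.
case=> us full es; split; first exact: uniq_copies.
  by case=> i k; rewrite mem_copies full.
by case=> [i k] [j l]; rewrite ladj_copies full es.
Qed.

(** A copy of T_9 inside [V] is recorded by the function that places its
    vertices; a member of the family is then the blow-up of a tree whose labels
    are such placements. *)
Section Blow.
Variable V : finType.
Local Notation label := {ffun T9 -> V}.
Implicit Types (t u : rtree V) (s : rtree label).

Definition blow s : rtree V := rmap (fun p : label * T9 => p.1 p.2) (copies s).

(** Collecting the children of a root in one list separates the copies of P_4
    of a centre, wherever they were grafted, from the members of the family
    that hang on it. *)
Definition sprout (W : Type) (t : rtree W) l := foldl (@Graft W) t l.

Lemma blow_sprout s l : blow (sprout s l) = sprout (blow s) (map blow l).
Proof. by elim: l s => //= a l IHl s; rewrite IHl. Qed.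

Lemma same_rooted_sprout t u l :
  same_rooted t u -> same_rooted (sprout t l) (sprout u l).
Proof.
elim: l t u => //= a l IHl t u tu; apply: IHl.
exact: same_rooted_Graft (same_rooted_refl a).
Qed.

Lemma same_rooted_Graft_sprout t u l :
  same_rooted (Graft (sprout t l) u) (sprout (Graft t u) l).
Proof.
elim: l t => //= a l IHl t; apply: same_rooted_trans (IHl _) _.
by apply: same_rooted_sprout; apply: same_rooted_swap.
Qed.

Definition P4_tree4 (p : V * V * V * V) :=
  let: (x, y, z, w) := p in P4_tree x y z w.

(** Two copies of P_4 and their centre form the placement of one copy of T_9. *)
Lemma sprout_blow x p q l :
  exists s, sprout (Vertex x) ([:: P4_tree4 p; P4_tree4 q] ++ map blow l) = blow s.
Proof.
move: p q => [[[p0 p1] p2] p3] [[[q0 q1] q2] q3].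
pose phi : label := [ffun k : T9 => if k is Some (b, i)
  then nth x (if b then [:: q0; q1; q2; q3] else [:: p0; p1; p2; p3]) i else x].
exists (sprout (Vertex phi) l); rewrite blow_sprout /sprout foldl_cat.
by congr foldl; rewrite /blow /= !ffunE.
Qed.

(** Each copy of P_4 is moved in front of the members of the family grafted
    before it; those members are blow-ups, their roots having both copies of
    P_4. *)
Lemma center_sprout k t : center k t -> exists x ps l,
  size ps = k /\ same_rooted t (sprout (Vertex x) (map P4_tree4 ps ++ map blow l)).
Proof.
elim=> {k t} [x|k t p _ [x [ps [l [sz st]]]] [a [b [c [d sp]]]]|
               k t u _ [x [ps [l [sz st]]]] _ [y [qs [m [sz2 su]]]]].
- by exists x, [::], [::].
- exists x, (rcons ps (a, b, c, d)), l; rewrite size_rcons sz; split=> //.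
  apply: same_rooted_trans (same_rooted_Graft st sp) _.
  rewrite map_rcons cat_rcons /sprout !foldl_cat; exact: same_rooted_Graft_sprout.
- case: qs sz2 su => [|p [|q [|? ?]]] // _ su.
  have [s es] := sprout_blow y p q m; exists x, ps, (rcons l s); split=> //.
  rewrite map_rcons -rcons_cat /sprout foldl_rcons.
  by apply: same_rooted_Graft; rewrite // -es.
Qed.

Lemma family_blow t : family_tree t -> exists s, same_tree t (blow s).
Proof.
case=> u /center_sprout[x [[|p [|q [|? ?]]] [l [// _ [_ su]]]]] tu.
have [s es] := sprout_blow x p q l; exists s.
by apply: same_tree_trans tu _; rewrite -es.
Qed.

End Blow.

Lemma family_in_family_F (G : sgraph) t :
  is_tree G -> decomposes (@adj G) t -> family_tree t -> in_family_F G.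
Proof.
move=> treeG dt /family_blow[s ts]; split=> //.
have us : uniq (verts s).
  have : uniq (verts (blow s)) by rewrite -(perm_uniq ts.1); case: dt.
  rewrite verts_rmap => /map_uniq.
  elim: {ts} s => //= a IHa b IHb; rewrite !cat_uniq => /and3P[/IHa-> dis /IHb->].
  rewrite andbT; apply: contra dis => /hasP[i ib ia]; apply/hasP.
  by exists (i, T9_center); rewrite /= mem_copies.
have [Q [f [s' [ds' es]]]] := rtree_graph us.
exists #|Q|, Q; split=> //.
- by rewrite -(size_decomposes ds') size_verts_gt0.
- exact: card_edges ds'.
apply: rmap_isomorphic (decomposes_copies ds') dt _.
by move: ts; rewrite /blow es copies_rmap rmap_comp; apply.
Qed.

Lemma path1_isomorphic (G : sgraph) t x :
  decomposes (@adj G) t -> same_tree t (Vertex x) -> isomorphic G (path_graph 1).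
Proof.
move=> dt st; have d1 : decomposes (@adj (path_graph 1)) (Vertex ord0).
  by split=> [//|i|i j]; rewrite ?(ord1 i) ?(ord1 j) ?inE.
exact: (@rmap_isomorphic _ _ (fun _ => x) _ _ d1 dt).
Qed.

Lemma path2_isomorphic (G : sgraph) t x y : decomposes (@adj G) t ->
  same_tree t (edge_tree x y) -> isomorphic G (path_graph 2).
Proof.
move=> dt st.
have d2 : decomposes (@adj (path_graph 2)) (edge_tree ord0 ord_max).
  have ord2P (i : 'I_2) : i = ord0 \/ i = ord_max.
    by case: i => [[|[|//]] ?]; [left|right]; apply: val_inj.
  split=> [//|i|i j]; first by case: (ord2P i) => ->.
  by case: (ord2P i) => ->; case: (ord2P j) => ->.
exact: (@rmap_isomorphic _ _ (fun i : path_graph 2 => nth x [:: x; y] i) _ _ d2 dt).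
Qed.

Lemma path4_isomorphic (G : sgraph) t x y z w : decomposes (@adj G) t ->
  same_tree t (P4_tree x y z w) -> isomorphic G (path_graph 4).
Proof.
move=> dt st; pose g (i : path_graph 4) := nth x [:: x; y; z; w] i.
exact: (@rmap_isomorphic _ _ g _ _ decomposes_path4 dt).
Qed.

(** * Lower bounds and the theorem *)

Lemma dominating_near (G : sgraph) (f : {ffun G -> 'I_3}) u :
  2 < #|G| -> dominating f ->
  exists2 v, 0 < f v &
    [\/ v = u, adj u v | 1 < f v /\ exists2 w, adj u w & adj w v].
Proof.
move=> G2 /forallP/(_ u)/existsP[v /andP[fv /walk_le_gdist near]].
have [|j le_j /walkP[p [pth lst sz]]] := near.
  by apply: leq_ltn_trans G2; rewrite -ltnS.
exists v => //; case: p pth lst sz => [|w [|z [|? ?]]] /=.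
- by move=> _ <- _; apply: Or31.
- by rewrite andbT => uw <- _; apply: Or32.
- case/and3P=> uw wz _ lst sz; apply: Or33; split; first by rewrite -sz in le_j.
  by exists w; rewrite -?lst.
- by have := ltn_ord (f v); lia.
Qed.

Lemma gamma_B2_gt0 (G : sgraph) (u : G) : 0 < gamma_B2 G.
Proof.
apply: gamma_B2_ge => f /forallP/(_ u)/existsP[v /andP[fv _]].
by rewrite /cost (bigD1 v) //= addn_gt0 fv.
Qed.

(** A leaf needs cost 1 at itself or its neighbour or cost 2 one step further;
    no single unit serves both leaves. *)
Lemma gamma_B2_P4 : 2 <= gamma_B2 (path_graph 4).
Proof.
apply: gamma_B2_ge => f df; rewrite /cost (sum_decomposes _ decomposes_path4) /=.
have big4 : 2 < #|path_graph 4| by rewrite card_ord.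
have nbr0 v : @adj (path_graph 4) o0 v -> v = o1 by case: (ord4P v) => ->.
have nbr1 v : @adj (path_graph 4) o1 v -> v = o0 \/ v = o2.
  by case: (ord4P v) => ->; auto.
have nbr2 v : @adj (path_graph 4) o2 v -> v = o1 \/ v = o3.
  by case: (ord4P v) => ->; auto.
have nbr3 v : @adj (path_graph 4) o3 v -> v = o2 by case: (ord4P v) => ->.
have : [\/ 0 < f o0, 0 < f o1 | 1 < f o2].
  have [v fv] := @dominating_near (path_graph 4) f o0 big4 df.
  case=> [ev|/nbr0 ev|[fv2 [w /nbr0-> /nbr1[]ev]]]; rewrite ev in fv *.
  - by apply: Or31.
  - by apply: Or32.
  - by apply: Or31.
  - by apply: Or33; rewrite -ev.
have : [\/ 0 < f o3, 0 < f o2 | 1 < f o1].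
  have [v fv] := @dominating_near (path_graph 4) f o3 big4 df.
  case=> [ev|/nbr3 ev|[fv2 [w /nbr3-> /nbr2[]ev]]]; rewrite ev in fv *.
  - by apply: Or31.
  - by apply: Or32.
  - by apply: Or33; rewrite -ev.
  - by apply: Or31.
rewrite !big_cons big_nil.
move: (f o0 : nat) (f o1 : nat) (f o2 : nat) (f o3 : nat) => a b c d.
by case=> ? [] ?; lia.
Qed.

(** Fix a copy of T_9.  Its leaves are out of reach of the other copies.  If a
    copy of P_4 has cost at most 1, this unit is spent on c or d to serve d,
    and a has to be served by cost 2 at the centre.  So either both
    copies of P_4 have cost at least 2, or the centre has cost 2 and each of
    them, because of d, at least 1. *)
Lemma gamma_B2_joinT9 (Q : sgraph) : 4 * #|Q| <= gamma_B2 (joinT9 Q).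
Proof.
apply: gamma_B2_ge => f df; rewrite /cost.
rewrite (eq_bigr (fun p => (f (p.1, p.2) : nat))); last by case.
rewrite -(pair_bigA _ (fun q k => (f (q, k) : nat))) mulnC -sum_nat_const.
apply: leq_sum => q _; rewrite (sum_decomposes _ decomposes_T9).
have big9 : 2 < #|joinT9 Q|.
  rewrite card_prod -(size_decomposes decomposes_T9).
  by have : 0 < #|Q| by [apply/card_gt0P; exists q]; case: #|Q|.
pose at_ b i : joinT9 Q := (q, Some (b, i)).
have nbr0 b v : @adj (joinT9 Q) (at_ b o0) v -> v = at_ b o1.
  case: v => r [[c j]|]; rewrite /= /joinT9_adj /= ?orbF.
    case/andP=> /eqP<- /andP[/eqP<-]; by case: (ord4P j) => ->.
  by rewrite andbF.
have nbr1 b v : @adj (joinT9 Q) (at_ b o1) v ->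
    [\/ v = at_ b o0, v = at_ b o2 | v = (q, None)].
  case: v => r [[c j]|]; rewrite /= /joinT9_adj /= ?orbF.
    case/andP=> /eqP<- /andP[/eqP<-]; case: (ord4P j) => -> // _.
      exact: Or31.
    exact: Or32.
  by rewrite andbT => /eqP<-; apply: Or33.
have nbr2 b v : @adj (joinT9 Q) (at_ b o2) v -> v = at_ b o1 \/ v = at_ b o3.
  case: v => r [[c j]|]; rewrite /= /joinT9_adj /= ?orbF.
    by case/andP=> /eqP<- /andP[/eqP<-]; case: (ord4P j) => ->; auto.
  by rewrite andbF.
have nbr3 b v : @adj (joinT9 Q) (at_ b o3) v -> v = at_ b o2.
  case: v => r [[c j]|]; rewrite /= /joinT9_adj /= ?orbF.
    case/andP=> /eqP<- /andP[/eqP<-]; by case: (ord4P j) => ->.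
  by rewrite andbF.
have leaf0 b : [\/ 0 < f (at_ b o0), 0 < f (at_ b o1), 1 < f (at_ b o2)
    | 1 < f (q, None)].
  have [v fv] := dominating_near (at_ b o0) big9 df.
  case=> [ev|/nbr0 ev|[fv2 [w /nbr0-> /nbr1[]ev]]]; rewrite ev in fv *.
  - by apply: Or41.
  - by apply: Or42.
  - by apply: Or41.
  - by apply: Or43; rewrite -ev.
  - by apply: Or44; rewrite -ev.
have leaf3 b : [\/ 0 < f (at_ b o3), 0 < f (at_ b o2) | 1 < f (at_ b o1)].
  have [v fv] := dominating_near (at_ b o3) big9 df.
  case=> [ev|/nbr3 ev|[fv2 [w /nbr3-> /nbr2[]ev]]]; rewrite ev in fv *.
  - by apply: Or31.
  - by apply: Or32.
  - by apply: Or33; rewrite -ev.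
  - by apply: Or31.
rewrite !big_cons big_nil.
move: (leaf0 true) (leaf0 false) (leaf3 true) (leaf3 false); rewrite /at_.
move: (f (q, None) : nat).
do 4 ![move: (f (q, Some (true, _)) : nat) (f (q, Some (false, _)) : nat)].
by move=> a b c d a' b' c' d' x [] ? [] ? [] ? [] ?; lia.
Qed.

Lemma ceil_eq (m n : nat) :
  let bound : int := Num.ceil (4%:R * n%:R / 9%:R : rat)%R in
  ((Posz m <= bound)%R = (9 * m < 4 * n + 9)) /\
  ((bound <= Posz m)%R = (4 * n <= 9 * m)).
Proof.
move=> bound; have key (z : int) :
    ((4%:R * n%:R / 9%:R : rat) <= z%:~R = ((4 * n)%:Z <= z * 9))%R.
  by rewrite ler_pdivrMr // -natrM -[9%:R%R]/(9%:~R)%R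
    -[(4 * n)%:R%R]/((4 * n)%:~R)%R -intrM ler_int.
split; last by rewrite /bound ceil_le_int key; lia.
have -> : (Posz m <= bound)%R = ~~ (bound <= m%:Z - 1)%R by lia.
by rewrite /bound ceil_le_int key; lia.
Qed.

Theorem theorem5 (T : sgraph) (hT : is_tree T) :
  let bound : int := Num.ceil (4%:R * #|T|%:R / 9%:R : rat)%R in
  (Posz (gamma_B2 T) <= bound)%R /\
  (Posz (gamma_B2 T) = bound <->
     in_family_F T \/ isomorphic T (path_graph 1) \/
     isomorphic T (path_graph 2) \/ isomorphic T (path_graph 4)).
Proof.
move=> bound; have [t dt] := tree_decomposes hT.
have [leE geE] := ceil_eq (gamma_B2 T) #|T|; rewrite -/bound in leE geE.
have le : (Posz (gamma_B2 T) <= bound)%R by rewrite leE; apply: gamma_B2_lt dt.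
split=> //; split=> [eq|ext]; last first.
  apply/eqP; rewrite Order.POrderTheory.eq_le le geE /=.
  case: ext => [[_ [_ [Q [_ _ _ iso]]]]|[iso|[iso|iso]]].
  - rewrite (gamma_B2_iso iso) (card_iso iso) card_prod.
    rewrite -(size_decomposes decomposes_T9) /=.
    by rewrite mulnA mulnC leq_mul2l gamma_B2_joinT9.
  - rewrite (gamma_B2_iso iso) (card_iso iso) card_ord.
    by have := @gamma_B2_gt0 (path_graph 1) ord0; lia.
  - rewrite (gamma_B2_iso iso) (card_iso iso) card_ord.
    by have := @gamma_B2_gt0 (path_graph 2) ord0; lia.
  - rewrite (gamma_B2_iso iso) (card_iso iso) card_ord.
    by have := gamma_B2_P4; lia.
have : 4 * #|T| <= 9 * gamma_B2 T by rewrite -geE eq.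
case/(gamma_B2_extremal dt) => [[x st]|[x [y st]]|[x [y [z [w st]]]]|ft].
- by right; left; apply: path1_isomorphic dt st.
- by right; right; left; apply: path2_isomorphic dt st.
- by right; right; right; apply: path4_isomorphic dt st.
- by left; apply: family_in_family_F dt ft.
Qed.
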